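(* Let $K$ be a field, let $n,d\ge 2$ be integers with $d\neq 3$, let $V(n,d)=\{\mathbf b\in\mathbb N^n:\sum_i b_i=d\}$, let $\mathbf a=(0,\dots,0,1,d-1)\in V(n,d)$ and $\Gamma=V(n,d)\setminus\{\mathbf a\}$. Then $K[\Gamma]$ is quadratic, i.e. the kernel $I(\Gamma)$ of the $K$-algebra surjection $S=K[x_\alpha:\alpha\in\Gamma]\to K[\Gamma]$, $x_\alpha\mapsto t^\alpha$, is generated by homogeneous polynomials of degree $2$.
   Context: $K[\Gamma]$ denotes the $K$-subalgebra of $K[t_1,\dots,t_n]$ generated by the monomials $t^\alpha=t_1^{\alpha_1}\cdots t_n^{\alpha_n}$, $\alpha\in\Gamma$; $S$ is a polynomial ring with one variable $x_\alpha$ of degree $1$ for each $\alpha\in\Gamma$. *)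

(* Defs.v *)
From HB Require Import structures.
From mathcomp Require Import all_boot all_order all_algebra.
From mathcomp Require Import mpoly.
Set Implicit Arguments. Unset Strict Implicit. Unset Printing Implicit Defensive.
Import Order.TTheory GRing.Theory.
Local Open Scope ring_scope.

(* The exponent vector a = (0,...,0,1,d-1) in N^n (needs n >= 2 to make sense). *)
Definition aVec (n d : nat) : 'X_{1..n} :=
  [multinom (if (i : nat) == n.-2 then 1%N else if (i : nat) == n.-1 then d.-1 else 0%N) | i < n].

(* Gamma = V(n,d) \ {a}, as a finite set of monomials of total degree d
   (all such monomials lie in the finite type of monomials of degree < d+1). *)
Definition Gamma (n d : nat) : {set 'X_{1..n < d.+1}} :=
  [set m : 'X_{1..n < d.+1} | (mdeg (val m) == d) && (val m != aVec n d)].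

Definition nGamma (n d : nat) : nat := #|Gamma n d|.

(* The exponent alpha attached to the i-th variable of S (a bijection
   'I_#|Gamma| -> Gamma). *)
Definition gam (n d : nat) (i : 'I_(nGamma n d)) : 'X_{1..n} :=
  val (enum_val i).

(* The K-algebra map S = K[x_alpha : alpha in Gamma] -> K[t_1..t_n],
   x_alpha |-> t^alpha (its image is K[Gamma]). *)
Definition toricMap (K : fieldType) (n d : nat) (p : {mpoly K[nGamma n d]}) : {mpoly K[n]} :=
  p \mPo [tuple 'X_[gam i] | i < nGamma n d].

Definition quadratic_kernel (K : fieldType) (n d : nat) : Prop :=
  forall p : {mpoly K[nGamma n d]}, toricMap p = 0 ->
    exists s : seq ({mpoly K[nGamma n d]} * {mpoly K[nGamma n d]}),
      (forall x, x \in s -> x.2 \is 2.-homog /\ toricMap x.2 = 0) /\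
      p = \sum_(x <- s) x.1 * x.2.

(* Main.v *)
Require Import Defs.
From HB Require Import structures.
From mathcomp Require Import all_boot all_order all_algebra.
From mathcomp Require Import mpoly zify.

(** A toric ideal is spanned by the binomials [X^e - X^f] whose exponents [e] and
    [f] have the same image, so it suffices to connect any two factorizations
    over Gamma of a monomial [m] by moves replacing two factors by two others
    with the same product.  We induct on the number of factors: if there are at
    least three, some [g] in Gamma, depending only on [m], can be made a factor
    of any factorization of [m], and is then cancelled.  Write [x] and [y] for
    the last and the second last variable, so that the omitted monomial is
    [y x^(d-1)].
    - If [x^d] divides [m], then [g = x^d].
    - If the [x]-degree of [m] is less than [d - 1], the omitted monomial never
      appears and [g] is any divisor of [m] of degree [d].
    - If that degree is [d - 1] and another variable [z] divides [m], then
      [g = z x^(d-1)]: factors containing [z] are never the omitted one.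
    - If [m] only involves [x] and [y] and has [x]-degree [d - 1], then
      [g = y^d]. *)

Set Implicit Arguments.
Unset Strict Implicit.
Unset Printing Implicit Defensive.
Import GRing.Theory.

(** * Divisors of monomials and exchanges of variables between two factors *)

Section Multinomials.
Variable n : nat.
Implicit Types (u v h e : 'X_{1..n}) (s : seq 'X_{1..n}) (i x : 'I_n).

Lemma mnm_le_mdeg u i : (u i <= mdeg u)%N.
Proof. by rewrite mdegE (bigD1 i) //= leq_addr. Qed.

Lemma mdeg_lt_exists h u : (mdeg h < mdeg u)%N -> exists i, (h i < u i)%N.
Proof.
move=> lt_hu; apply/existsP; apply: contraLR lt_hu.
rewrite negb_exists -leqNgt !mdegE => /forallP le_uh.
by apply: leq_sum => i _; rewrite leqNgt le_uh.
Qed.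

Lemma lepm_mdeg_eq h u : (h <= u)%MM -> mdeg u = mdeg h -> h = u.
Proof.
move=> le_hu; rewrite -{1}(submK le_hu) mdegD => deg0.
have /eqP : mdeg (u - h) = 0%N by lia.
by rewrite mdeg_eq0 => /eqP uh0; rewrite -[u in RHS](submK le_hu) uh0 add0m.
Qed.

Lemma lepm_mdeg_exists k e : (k <= mdeg e)%N ->
  exists2 h, (h <= e)%MM & mdeg h = k.
Proof.
elim: k => [|k IHk] le_ke; first by exists 0%MM; [apply/mnm_lepP => i; rewrite mnm0E | rewrite mdeg0].
have [h le_he deg_h] := IHk (ltnW le_ke).
have [|i lt_i] := @mdeg_lt_exists h e; first by rewrite deg_h.
exists (h + U_(i))%MM; last by rewrite mdegD mdeg1 deg_h addn1.
apply/mnm_lepP => j; rewrite mnmDE mnm1E.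
by have := mnm_lepP le_he j; case: eqP => [<-|_]; lia.
Qed.

(** A variable [r] that [u] has in excess over [h] is traded for an [i] of [v]. As [u i <= h i], [r]
    differs from [i], so [h] still divides [u] after the loss of [r]. *)
Lemma mnm_swap h u v i :
    mdeg u = mdeg v -> (h <= u)%MM -> (mdeg h < mdeg u)%N ->
    (u i <= h i)%N -> (0 < v i)%N ->
  exists u' v', [/\ mdeg u' = mdeg u, mdeg v' = mdeg u,
    (u' + v' = u + v)%MM & (h + U_(i) <= u')%MM].
Proof.
move=> deg_uv le_hu lt_deg le_ui v_gt0; have [r lt_r] := mdeg_lt_exists lt_deg.
have neq_ri : r != i by apply: contraTneq lt_r => ->; lia.
have le_ru : (U_(r) <= u)%MM.
  by apply/mnm_lepP => j; rewrite mnm1E; case: eqP => // <-; lia.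
have le_iv : (U_(i) <= v)%MM.
  by apply/mnm_lepP => j; rewrite mnm1E; case: eqP => // <-; lia.
have deg_u : mdeg u = (mdeg (u - U_(r))).+1.
  by rewrite -{1}(submK le_ru) mdegD mdeg1 addn1.
have deg_v : mdeg v = (mdeg (v - U_(i))).+1.
  by rewrite -{1}(submK le_iv) mdegD mdeg1 addn1.
exists (u - U_(r) + U_(i))%MM, (v - U_(i) + U_(r))%MM; split.
- by rewrite mdegD mdeg1; lia.
- by rewrite mdegD mdeg1; lia.
- rewrite -{2}(submK le_ru) -{2}(submK le_iv).
  by apply/mnmP => j; rewrite !mnmDE; lia.
- apply/mnm_lepP => j; rewrite !mnmDE mnmBE !mnm1E.
  have := mnm_lepP le_hu j; case: (r =P j) => [<-|_]; last by lia.
  by rewrite eq_sym (negPf neq_ri); lia.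
Qed.

(** Let [e] be the product [u + v] stripped of [x]. Any divisor of [e] of degree [d - c] completes
    [x^c] to a first factor, and the rest is the second one. Such a divisor exists because
    [u x + v x <= d + c] says exactly that [e] has degree at least [d - c]. *)
Lemma mnm_transfer (d : nat) u v x c :
    mdeg u = d -> mdeg v = d ->
    (c <= d)%N -> (c <= u x + v x)%N -> (u x + v x <= d + c)%N ->
  exists u' v', [/\ mdeg u' = d, mdeg v' = d, (u' + v' = u + v)%MM,
    u' x = c & (c + v' x = u x + v x)%N].
Proof.
move=> deg_u deg_v le_cd le_c le_dc.
pose e := ((u + v) - U_(x) *+ (u + v)%MM x)%MM.
have uvE : (e + U_(x) *+ (u + v)%MM x = u + v)%MM.
  apply: submK; apply/mnm_lepP => j; rewrite mulmnE mnm1E.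
  by case: eqP => [->|]; rewrite ?mul1n.
have ex0 : e x = 0%N by rewrite mnmBE mulmnE mnm1E eqxx mul1n subnn.
have deg_e : (mdeg e + (u x + v x) = d + d)%N.
  by rewrite -{1}deg_u -deg_v -mdegD -uvE mdegD mdegMn mdeg1 mul1n mnmDE.
have [h le_he deg_h] : exists2 h, (h <= e)%MM & mdeg h = (d - c)%N.
  by apply: lepm_mdeg_exists; lia.
have hx0 : h x = 0%N by have := mnm_lepP le_he x; lia.
have deg_eh : mdeg e = (mdeg (e - h) + mdeg h)%N.
  by rewrite -{1}(submK le_he) mdegD.
exists (h + U_(x) *+ c)%MM, (e - h + U_(x) *+ (u x + v x - c))%MM; split.
- by rewrite mdegD mdegMn mdeg1; lia.
- by rewrite mdegD mdegMn mdeg1; lia.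
- rewrite -uvE -{2}(submK le_he); apply/mnmP => j.
  by rewrite !(mnmDE, mulmnE) mnm1E; case: (x =P j) => [<-|_]; lia.
- by rewrite mnmDE mulmnE mnm1E eqxx hx0; lia.
- by rewrite mnmDE mulmnE mnm1E eqxx mnmBE ex0 hx0; lia.
Qed.

Lemma mnm_sum_gt0 s i : (0 < (\sum_(u <- s) u)%MM i)%N ->
  exists2 v : 'X_{1..n}, (0 < v i)%N & exists t, perm_eq s (v :: t).
Proof.
rewrite mnm_sumE => sum_gt0; suff /hasP [v sv vi] : has (fun v => 0 < v i)%N s.
  by exists v => //; exists (rem v s); apply: perm_to_rem.
apply: contraTT sum_gt0 => /hasPn all0; rewrite lt0n negbK.
rewrite sum_nat_seq_eq0; apply/allP => v /all0; rewrite lt0n negbK.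
by move=> ->.
Qed.

Lemma mdeg_sum_const (d : nat) s : all (fun u => mdeg u == d) s ->
  mdeg (\sum_(u <- s) u)%MM = (size s * d)%N.
Proof.
move=> /allP deg_s; rewrite mdeg_sum big_seq (eq_bigr (fun _ => d)).
  by rewrite -big_seq big_const_seq count_predT iter_addn_0 mulnC.
by move=> u /deg_s /eqP.
Qed.

End Multinomials.

(** * Factorizations over Gamma of a fixed monomial and their connectedness *)

Section Fibres.
Variables (n d : nat) (x y : 'I_n).
Hypotheses (neq_xy : x != y) (d_ge2 : (2 <= d)%N) (d_neq3 : d <> 3%N).

Local Notation M := 'X_{1..n}.
Implicit Types (u v w g h m : M) (s t : seq M).

Definition omitted : M := (U_(y) + U_(x) *+ d.-1)%MM.
Definition inG u := (mdeg u == d) && (u != omitted).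
Definition fib m s := all inG s /\ (\sum_(u <- s) u)%MM = m.

(** A list of factors stands for a monomial of S, so permutations are free. They also let a pair
    move, stated at the head, act on any two factors. *)
Inductive conn : seq M -> seq M -> Prop :=
| conn_perm s t : perm_eq s t -> conn s t
| conn_pair u v u' v' s : inG u -> inG v -> inG u' -> inG v' ->
    (u + v = u' + v')%MM -> conn (u :: v :: s) (u' :: v' :: s)
| conn_trans s2 s1 s3 : conn s1 s2 -> conn s2 s3 -> conn s1 s3.

Lemma conn_sym s t : conn s t -> conn t s.
Proof.
elim=> [{}s {}t st | u v u' v' {}s Gu Gv Gu' Gv' eq_uv | s2 s1 s3 _ s21 _ s32].
- by apply: conn_perm; rewrite perm_sym.
- by apply: conn_pair.
- exact: conn_trans s32 s21.
Qed.

Lemma conn_cons g s t : conn s t -> conn (g :: s) (g :: t).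
Proof.
elim=> [{}s {}t st | u v u' v' {}s Gu Gv Gu' Gv' eq_uv | s2 s1 s3 _ s12 _ s23].
- by apply: conn_perm; rewrite perm_cons.
(* [g] is permuted behind the pair, which has to be at the head to be moved. *)
- apply: (@conn_trans [:: u, v, g & s]).
    by apply: conn_perm; apply/permP => p /=; lia.
  apply: (@conn_trans [:: u', v', g & s]); first exact: conn_pair.
  by apply: conn_perm; apply/permP => p /=; lia.
- exact: conn_trans s12 s23.
Qed.

Lemma conn_fib m s t : conn s t -> fib m s -> fib m t.
Proof.
move=> st; elim: st m => {s t} [s t st | u v u' v' s Gu Gv Gu' Gv' eq_uv | s2 s1 s3 _ s12 _ s23] m.
- by case=> Gs sum_s; split; [rewrite -(perm_all _ st) | rewrite -(perm_big _ st)].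
- rewrite /fib /= Gu' Gv' => -[/and3P [_ _ ->] <-]; split=> //.
  by rewrite !big_cons !addmA eq_uv.
- by move=> /s12 /s23.
Qed.

Lemma perm_fib m s t : perm_eq s t -> fib m s -> fib m t.
Proof. by move=> st; apply/conn_fib/conn_perm. Qed.

Lemma inG_deg u : inG u -> mdeg u = d.
Proof. by case/andP => /eqP. Qed.

Lemma inG_le u i : inG u -> (u i <= d)%N.
Proof. by move=> /inG_deg <-; apply: mnm_le_mdeg. Qed.

Lemma omitted_x : omitted x = d.-1.
Proof. by rewrite mnmDE mulmnE !mnm1E eqxx eq_sym (negPf neq_xy) mul1n. Qed.

Lemma omitted_z z : z != x -> z != y -> omitted z = 0%N.
Proof.
move=> zx zy; rewrite mnmDE mulmnE !mnm1E.
by rewrite eq_sym (negPf zy) eq_sym (negPf zx).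
Qed.

Lemma inG_x u : mdeg u = d -> u x <> d.-1 -> inG u.
Proof.
by move=> deg_u neq; rewrite /inG deg_u eqxx; apply: contra_not_neq neq => ->; rewrite omitted_x.
Qed.

Lemma fib_cons_x m u s : fib m (u :: s) -> (u x + (\sum_(v <- s) v)%MM x = m x)%N.
Proof. by case=> _ <-; rewrite big_cons mnmDE. Qed.

Lemma fib_le m u s : fib m (u :: s) -> (u <= m)%MM.
Proof. by case=> _ <-; rewrite big_cons lem_addr. Qed.

Lemma fib_deg m s : fib m s -> mdeg m = (size s * d)%N.
Proof.
case=> /allP Gs <-; apply: mdeg_sum_const.
by apply/allP => u /Gs /andP [].
Qed.

(** The last two hypotheses keep both new [x]-degrees away from [d - 1], the [x]-degree of
    [omitted], so the new factors lie in Gamma whatever their other variables are. *)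
Lemma fib_merge m u v s c : fib m [:: u, v & s] ->
    (c <= d)%N -> (c <= u x + v x)%N -> (u x + v x <= d + c)%N ->
    c <> d.-1 -> (u x + v x)%N <> (c + d.-1)%N ->
  exists u' v', [/\ conn [:: u, v & s] [:: u', v' & s],
    u' x = c & (c + v' x = u x + v x)%N].
Proof.
case=> /= /and3P [Gu Gv Gs] _ le_cd le_c le_dc neq_c neq_c'.
have [u' [v' [deg_u' deg_v' eq_uv u'x v'x]]] :=
  mnm_transfer (inG_deg Gu) (inG_deg Gv) le_cd le_c le_dc.
exists u', v'; split=> //; apply: conn_pair => //; try (by apply: inG_x; lia).
Qed.

Lemma fib_merge_full m u v s : fib m [:: u, v & s] ->
    (u x < d)%N -> (d <= u x + v x)%N ->
  exists u' s', conn [:: u, v & s] (u' :: s') /\ u' x = d.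
Proof.
move=> fib_s lt_ud le_d.
have le_vd : (v x <= d)%N by case: fib_s => /= /and3P [_ /(inG_le x)].
(* If [v x = d], then [v] already serves. Otherwise [u x + v x <= 2d - 2], and moving [d] copies of
   [x] into one factor leaves at most [d - 2] in the other. *)
have [vx|neq_vd] := v x =P d.
  exists v, (u :: s); split=> //; apply: conn_perm.
  by apply/permP => p /=; lia.
have [||||| u' [v' [cuv u'x _]]] := fib_merge (c := d) fib_s; try lia.
by exists u', (v' :: s).
Qed.

(* The x-degree of the first factor is raised one unit at a time.  The only
   obstruction is a pair of factors of x-degrees d - 2 and 1, where the result
   could be forced to be [omitted]; a third factor containing x then helps,
   because d <> 3 makes x-degree 2 harmless. *)
Lemma reach_full m s : fib m s -> (d <= m x)%N ->
  exists s', conn s ((U_(x) *+ d)%MM :: s').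
Proof.
move=> fib_s le_dm.
have reach j : (j <= d)%N ->
    exists u s', conn s (u :: s') /\ (j <= u x)%N.
  elim: j => [|j IHj] le_jd.
    case: s fib_s => [|u s] fib_s; last by exists u, s; split=> //; apply: conn_perm.
    by case: fib_s le_dm => _ <-; rewrite big_nil mnm0E; lia.
  have [u [s1 [cs1 le_ju]]] := IHj (ltnW le_jd).
  have [lt_ju|le_uj] := ltnP j (u x); first by exists u, s1.
  have full t u1 v1 : conn s [:: u1, v1 & t] -> (u1 x < d)%N ->
      (d <= u1 x + v1 x)%N -> exists u s', conn s (u :: s') /\ (j < u x)%N.
    move=> ct u1_lt le_d.
    have [u' [s' [cu' u'x]]] := fib_merge_full (conn_fib ct fib_s) u1_lt le_d.
    by exists u', s'; rewrite u'x; split=> //; apply: conn_trans cu'.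
  have fib1 := conn_fib cs1 fib_s; have x1 := fib_cons_x fib1.
  have [|v v_gt0 [t s1t]] := @mnm_sum_gt0 _ s1 x; first by lia.
  have cs2 : conn s [:: u, v & t].
    by apply: conn_trans cs1 _; apply: conn_perm; rewrite perm_cons.
  have [le_d|gt_d] := leqP d (u x + v x); first by apply: full cs2 _ le_d; lia.
  have fib2 := conn_fib cs2 fib_s.
  have [jd|jd] := (j.+1 =P d.-1); last first.
    have [||||| u' [v' [cu' u'x _]]] := fib_merge (c := j.+1) fib2; try lia.
    by exists u', (v' :: t); rewrite u'x; split=> //; apply: conn_trans cu'.
  have x2 := fib_cons_x fib2; rewrite big_cons mnmDE in x2.
  have [|w w_gt0 [t' tt']] := @mnm_sum_gt0 _ t x; first by lia.
  have [le_d|w_lt] := leqP d (u x + w x).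
    apply: (full (v :: t') u w) => //; last by lia.
    apply: conn_trans cs2 _; apply: conn_perm; move/permP: tt' => tt'.
    by apply/permP => p; have /= := tt' p; lia.
  have cs3 : conn s [:: v, w, u & t'].
    apply: conn_trans cs2 _; apply: conn_perm; move/permP: tt' => tt'.
    by apply/permP => p; have /= := tt' p; lia.
  have [||||| v' [w' [cv' v'x _]]] :=
    fib_merge (c := 2) (conn_fib cs3 fib_s); try lia.
  apply: (full (w' :: t') u v'); try lia.
  apply: conn_trans (conn_trans cs3 cv') _; apply: conn_perm.
  by apply/permP => p /=; lia.
have [u [s' [cs' le_du]]] := reach d (leqnn d).
exists s'; suff -> : (U_(x) *+ d)%MM = u by [].
have [/= /andP [Gu _] _] := conn_fib cs' fib_s.
apply: lepm_mdeg_eq; last by rewrite mdegMn mdeg1 (inG_deg Gu) mul1n.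
by apply/mnm_lepP => i; rewrite mulmnE mnm1E; case: eqP => [<-|_]; rewrite ?mul1n.
Qed.

(** Here [h] is the part of [g] already secured in the first factor; it grows by one variable [i] at
    a time, fetched from another factor by [mnm_swap] if necessary. The first condition on [w]
    protects the new first factor, a multiple of [h]. The second protects the factor that gave up
    [i]: its product with [i] still divides [m], since [i] now divides the first factor. *)
Lemma climb m h g u s : mdeg g = d -> (h <= g)%MM -> (g <= m)%MM ->
    (forall w, (h <= w)%MM -> (w <= m)%MM -> w != omitted) ->
    (forall i w, (h i < g i)%N -> (w + U_(i) <= m)%MM -> w != omitted) ->
    fib m (u :: s) -> (h <= u)%MM ->
  exists s', conn (u :: s) (g :: s').
Proof.
move=> deg_g; have [k] := ubnP (d - mdeg h)%N.
elim: k h u s => // k IHk h u s lt_k le_hg le_gm H1 H2 fib_s le_hu.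
have [/= /andP [Gu Gs] _] := fib_s; have deg_u := inG_deg Gu.
have [le_d|lt_d] := leqP d (mdeg h).
  have deg_h : mdeg h = d.
    by apply/eqP; rewrite eqn_leq le_d -deg_g -(submK le_hg) mdegD leq_addl.
  have hg : h = g by apply: lepm_mdeg_eq; rewrite ?deg_h.
  have hu : h = u by apply: lepm_mdeg_eq; rewrite ?deg_h.
  by exists s; rewrite -hg -hu; apply: conn_perm.
have [|i lt_i] := @mdeg_lt_exists _ h g; first by rewrite deg_g.
have le_hi w : (h <= w)%MM -> (h i < w i)%N -> (h + U_(i) <= w)%MM.
  move=> /mnm_lepP le_hw lt_w; apply/mnm_lepP => j; rewrite mnmDE mnm1E.
  by have := le_hw j; case: eqP => [<-|_]; lia.
have le_h : (h <= h + U_(i))%MM by rewrite lem_addr.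
have {}IHk w t : (h + U_(i) <= w)%MM -> fib m (w :: t) ->
    exists s', conn (w :: t) (g :: s').
  move=> le_w fib_w; apply: (IHk (h + U_(i))%MM) => //.
  - by rewrite mdegD mdeg1; lia.
  - exact: le_hi.
  - by move=> w' /(lepm_trans le_h); apply: H1.
  - move=> j w' lt_j; apply: H2; apply: leq_ltn_trans lt_j.
    by rewrite mnmDE leq_addr.
have [lt_ui|le_ui] := ltnP (h i) (u i); first by apply: IHk => //; apply: le_hi.
have sum_i : (u i + (\sum_(v <- s) v)%MM i = m i)%N.
  by case: fib_s => _ <-; rewrite big_cons mnmDE.
(* Since [u i <= h i < g i <= m i], a factor other than the first contains [i]. *)
have [|v v_gt0 [t st]] := @mnm_sum_gt0 _ s i.
  by have := mnm_lepP le_gm i; lia.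
have cs : conn (u :: s) [:: u, v & t] by apply: conn_perm; rewrite perm_cons.
have fib_t := conn_fib cs fib_s; have [/= /and3P [_ Gv _] sum_t] := fib_t.
have deg_v := inG_deg Gv.
have [||u' [v' [deg_u' deg_v' eq_uv le_u']]] := mnm_swap _ le_hu _ le_ui v_gt0.
- by rewrite deg_u.
- by rewrite deg_u.
have le_m : (u' + v' <= m)%MM by rewrite -sum_t !big_cons addmA eq_uv lem_addr.
have Gu' : inG u'.
  rewrite /inG deg_u' deg_u eqxx H1 ?(lepm_trans le_h) //.
  by apply: lepm_trans le_m; rewrite lem_addr.
have Gv' : inG v'.
  rewrite /inG deg_v' deg_u eqxx (H2 i) //.
  apply: lepm_trans le_m; apply/mnm_lepP => j; rewrite !mnmDE addnC leq_add2r.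
  by apply: leq_trans (mnm_lepP le_u' j); rewrite mnmDE leq_addl.
have cs' : conn (u :: s) [:: u', v' & t].
  by apply: conn_trans cs _; apply: conn_pair.
have [s' cs''] := IHk _ _ le_u' (conn_fib cs' fib_s).
by exists s'; apply: conn_trans cs''.
Qed.

(** No divisor of [m] has [x]-degree [d - 1], so [climb] can start from [h = 0]. *)
Lemma reach_low m g s : fib m s -> (m x < d.-1)%N -> mdeg g = d -> (g <= m)%MM ->
  exists s', conn s (g :: s').
Proof.
move=> fib_s lt_m deg_g le_gm.
have safe w : (w <= m)%MM -> w != omitted.
  by move=> /mnm_lepP /(_ x) le_w; apply: contraTneq lt_m => wa; rewrite wa omitted_x in le_w; lia.
have le0 w : (0 <= w)%MM by apply/mnm_lepP => i; rewrite mnm0E.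
case: s fib_s => [|u s] fib_s.
  by move: (fib_deg fib_s) deg_g; rewrite -(submK le_gm) mdegD /=; lia.
apply: (climb (h := 0%MM) (m := m)) => // [w _|i w _ le_w]; first exact: safe.
by apply: safe; apply: lepm_trans le_w; rewrite lem_addr.
Qed.

(** Apply [climb] with [h = z]. Multiples of [z] differ from [omitted], and only copies of [x]
    remain to be fetched: if [w x] divides [m], then [w] has [x]-degree at most [d - 2]. *)
Lemma reach_mid m z s : fib m s -> m x = d.-1 -> z != x -> z != y -> (0 < m z)%N ->
  exists s', conn s ((U_(z) + U_(x) *+ d.-1)%MM :: s').
Proof.
move=> fib_s mx zx zy mz.
have [|u u_gt0 [t st]] := @mnm_sum_gt0 _ s z; first by case: fib_s => _ ->.
have fib_t := perm_fib st fib_s.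
have [] // := @climb m U_(z)%MM (U_(z) + U_(x) *+ d.-1)%MM u t.
- by rewrite mdegD mdegMn !mdeg1; lia.
- by rewrite lem_addr.
- apply/mnm_lepP => i; rewrite mnmDE mulmnE !mnm1E.
  case: (z =P i) => [<-|_]; first by rewrite eq_sym (negPf zx); lia.
  by case: eqP => [<-|]; lia.
- move=> w /mnm_lepP /(_ z); rewrite mnm1E eqxx => wz _.
  by apply: contraTneq wz => ->; rewrite omitted_z.
- move=> i w; rewrite mnmDE mulmnE !mnm1E.
  case: (x =P i) => [<-|_]; last by lia.
  move=> _ /mnm_lepP /(_ x); rewrite mnmDE mnm1E eqxx mx => wx.
  by apply: contraTneq wx => ->; rewrite omitted_x; lia.
- by apply/mnm_lepP => i; rewrite mnm1E; case: eqP => [<-|].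
by move=> s' ct; exists s'; apply: conn_trans ct; apply: conn_perm.
Qed.

(** Only [x] and [y] occur, so a factor free of [x] is [y^d]. *)
Lemma reach_binary m s : fib m s -> (2 < size s)%N -> m x = d.-1 ->
    (forall z, z != x -> z != y -> m z = 0%N) ->
  exists s', conn s ((U_(y) *+ d)%MM :: s').
Proof.
move=> fib_s size_s mx mz.
have free u t : conn s (u :: t) -> u x = 0%N ->
    exists s', conn s ((U_(y) *+ d)%MM :: s').
  move=> ct ux; exists t; suff <- : u = (U_(y) *+ d)%MM by [].
  have fib_t := conn_fib ct fib_s; have [/= /andP [Gu _] _] := fib_t.
  apply: lepm_mdeg_eq; last by rewrite (inG_deg Gu) mdegMn mdeg1 mul1n.
  apply/mnm_lepP => i; rewrite mulmnE mnm1E.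
  case: (y =P i) => [<-|/eqP yi]; first by have := inG_le y Gu; lia.
  have [->|ix] := eqVneq i x; first by rewrite ux.
  by have := mnm_lepP (fib_le fib_t) i; rewrite mz // eq_sym.
case: s fib_s size_s free => [|u [|v [|w s]]] // fib_s _ free.
have [ux|ux] := u x =P 0%N; first by apply: (free u [:: v, w & s]) => //; apply: conn_perm.
have [wx|wx] := w x =P 0%N.
  by apply: (free w [:: u, v & s]) => //; apply: conn_perm; apply/permP => p /=; lia.
have := fib_cons_x fib_s; rewrite !big_cons !mnmDE mx => sum_x.
(* The third factor [w] contains [x], so [u x + v x <= d - 2]: all copies of [x] in [u] and [v] fit
   into one factor without making it [omitted]. *)
have [||||| u' [v' [cu' u'x v'x]]] := fib_merge (c := (u x + v x)%N) fib_s; try lia.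
apply: (free v' [:: u', w & s]); last by lia.
by apply: conn_trans cu' _; apply: conn_perm; apply/permP => p /=; lia.
Qed.

Lemma fib_common m s0 : fib m s0 -> (2 < size s0)%N ->
  exists g, forall s, fib m s -> exists s', conn s (g :: s').
Proof.
move=> fib0 size0.
have size_eq s : fib m s -> size s = size s0.
  move=> /fib_deg; rewrite (fib_deg fib0) => /eqP.
  by rewrite eqn_pmul2r; [move/eqP | lia].
have [le_d|lt_d] := leqP d (m x).
  by exists (U_(x) *+ d)%MM => s fib_s; apply: reach_full le_d.
have [lt_m|le_m] := ltnP (m x) d.-1.
  have [|g le_g deg_g] := @lepm_mdeg_exists _ d m.
    by rewrite (fib_deg fib0); nia.
  by exists g => s fib_s; apply: (reach_low fib_s).
have mx : m x = d.-1 by lia.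
have [/existsP [z /and3P [zx zy mz]]|no_z] :=
    boolP [exists z, [&& z != x, z != y & 0 < m z]%N].
  by exists (U_(z) + U_(x) *+ d.-1)%MM => s fib_s; apply: (reach_mid fib_s).
exists (U_(y) *+ d)%MM => s fib_s; apply: (reach_binary fib_s) => //.
  by rewrite size_eq.
move=> z zx zy; apply/eqP; rewrite -leqn0 leqNgt; apply: contra no_z => mz.
by apply/existsP; exists z; rewrite zx zy.
Qed.

Lemma fib_conn m s t : fib m s -> fib m t -> conn s t.
Proof.
have [k] := ubnP (size s); elim: k m s t => // k IHk m s t lt_k fib_s fib_t.
have size_t : size t = size s.
  have /eqP := fib_deg fib_s; rewrite (fib_deg fib_t).
  by rewrite eqn_pmul2r; [move/eqP | lia].
have [gt2|le2] := ltnP 2 (size s).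
  have [g reach] := fib_common fib_s gt2.
  have [s' cs] := reach _ fib_s; have [t' ct] := reach _ fib_t.
  have fib_s' := conn_fib cs fib_s; have fib_t' := conn_fib ct fib_t.
  apply: conn_trans cs _; apply: conn_trans (conn_sym ct); apply: conn_cons.
  have eq_size : (size s).-1 = size s'.
    have /eqP := fib_deg fib_s; rewrite (fib_deg fib_s').
    by rewrite eqn_pmul2r; [move/eqP => /= <- | lia].
  case: fib_s' fib_t' => /= /andP [_ Gs'] sum_s' [/= /andP [_ Gt'] sum_t'].
  apply: (IHk (\sum_(u <- s') u)%MM) => //; first by lia.
  split=> //; apply: (@addmI _ g); move: sum_t'.
  by rewrite -sum_s' !big_cons.
(* With at most two factors, a single permutation or pair move suffices. *)
case: s t size_t le2 fib_s fib_t {lt_k} => [|u [|v [|? ?]]] [|u' [|v' [|? ?]]] //= _ _.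
- by move=> _ _; apply: conn_perm.
- by move=> [_ <-] [_]; rewrite !big_seq1 => ->; apply: conn_perm.
- move=> [/= /and3P [Gu Gv _] <-] [/= /and3P [Gu' Gv' _]].
  rewrite !big_cons !big_nil !addm0 => eq_uv.
  by apply: conn_pair.
Qed.

End Fibres.

(** * From connected fibres to quadratic generators of the toric ideal *)

Section QuadraticIdeal.
Local Open Scope ring_scope.
Variables (K : fieldType) (n d : nat).

Local Notation N := (nGamma n d).
Local Notation S := {mpoly K[N]}.

(** Phrased as the conclusion of [quadratic_kernel], to be convertible with it. *)
Definition in_quad_ideal (p : S) := exists s : seq (S * S),
  (forall x, x \in s -> x.2 \is 2.-homog /\ toricMap x.2 = 0) /\
  p = \sum_(x <- s) x.1 * x.2.

Lemma in_quad_ideal0 : in_quad_ideal 0.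
Proof. by exists [::]; rewrite big_nil. Qed.

Lemma in_quad_idealD p q :
  in_quad_ideal p -> in_quad_ideal q -> in_quad_ideal (p + q).
Proof.
move=> [s [Hs ->]] [t [Ht ->]]; exists (s ++ t); rewrite big_cat; split=> // r.
by rewrite mem_cat => /orP [/Hs | /Ht].
Qed.

Lemma in_quad_idealM p q : in_quad_ideal q -> in_quad_ideal (p * q).
Proof.
move=> [s [Hs ->]]; exists [seq (p * r.1, r.2) | r <- s]; split.
  by move=> _ /mapP [r /Hs Hr ->].
by rewrite big_map big_distrr /=; apply: eq_bigr => r _; rewrite mulrA.
Qed.

Lemma in_quad_ideal_gen p :
  p \is 2.-homog -> toricMap p = 0 -> in_quad_ideal p.
Proof.
move=> hom_p ker_p; exists [:: (1, p)]; rewrite big_seq1 mul1r; split=> // r.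
by rewrite inE => /eqP ->.
Qed.

Lemma in_quad_ideal_sum (I : eqType) (r : seq I) (F : I -> S) :
  (forall i, i \in r -> in_quad_ideal (F i)) ->
  in_quad_ideal (\sum_(i <- r) F i).
Proof.
elim: r => [|i r IHr] HF; first by rewrite big_nil; apply: in_quad_ideal0.
rewrite big_cons; apply: in_quad_idealD; first by apply: HF; rewrite mem_head.
by apply: IHr => j rj; apply: HF; rewrite inE rj orbT.
Qed.

(** This is the multigrading of S in which [x_alpha] has degree [alpha]. *)
Definition toric_exp (e : 'X_{1..N}) : 'X_{1..n} := (\sum_i gam i *+ e i)%MM.

Lemma toric_expD e f : toric_exp (e + f) = (toric_exp e + toric_exp f)%MM.
Proof.
apply/mnmP => j; rewrite mnmDE !mnm_sumE -big_split /=.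
by apply: eq_bigr => i _; rewrite !mulmnE mnmDE mulnDr.
Qed.

Lemma toric_exp1 i : toric_exp U_(i) = gam i.
Proof.
apply/mnmP => j; rewrite mnm_sumE (bigD1 i) //= big1 => [|k ki].
  by rewrite mulmnE mnm1E eqxx muln1 addn0.
by rewrite mulmnE mnm1E eq_sym (negPf ki) muln0.
Qed.

Lemma toricMapX e : toricMap 'X_[K, e] = 'X_[toric_exp e].
Proof.
rewrite /toricMap comp_mpolyX /toric_exp.
rewrite (big_morph (fun m => 'X_[K, m]) (@mpolyXD n K) (mpolyX0 n K)).
by apply: eq_bigr => i _; rewrite tnth_mktuple mpolyXn.
Qed.

Lemma toricMapB (p q : S) : toricMap (p - q) = toricMap p - toricMap q.
Proof. exact: comp_mpolyB. Qed.

(* In p minus the sum of its terms c (X^e - X^(rep e)), where rep e only depends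
   on the toric image of e, the coefficients are those of the image of p. *)
Lemma quadratic_kernel_of_binomials :
  (forall e f : 'X_{1..N}, toric_exp e = toric_exp f ->
     in_quad_ideal ('X_[e] - 'X_[f])) ->
  quadratic_kernel K n d.
Proof.
move=> binom p ker_p; suff: in_quad_ideal p by [].
(* The default 0 is never met below: [rep] is only summed over images of exponents in the support of
   [p]. *)
pose rep (m : 'X_{1..n}) :=
  nth 0%MM [seq e <- msupp p | toric_exp e == m] 0.
have repP e : e \in msupp p -> toric_exp (rep (toric_exp e)) = toric_exp e.
  move=> pe; have : rep (toric_exp e) \in [seq f <- msupp p | toric_exp f == toric_exp e].
    rewrite /rep mem_nth // size_filter -has_count.
    by apply/hasP; exists e.
  by rewrite mem_filter => /andP [/eqP].
have rep0 : \sum_(e <- msupp p) p@_e *: 'X_[K, rep (toric_exp e)] = 0.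
  pose r := undup (map toric_exp (msupp p)).
  transitivity (\sum_(m <- r) (toricMap p)@_m *: 'X_[K, rep m]); last first.
    by rewrite big1 // => m _; rewrite ker_p mcoeff0 scale0r.
  have coefE m : (toricMap p)@_m =
      \sum_(e <- msupp p) p@_e * (toric_exp e == m)%:R.
    rewrite /toricMap comp_mpolyEX raddf_sum /=.
    by apply: eq_bigr => e _; rewrite mcoeffZ -/(toricMap _) toricMapX mcoeffX.
  under [RHS]eq_bigr => m _ do rewrite coefE scaler_suml.
  rewrite exchange_big /=; apply: eq_big_seq => e pe.
  have re : toric_exp e \in r by rewrite mem_undup map_f.
  rewrite (bigD1_seq _ re) ?undup_uniq //= eqxx mulr1 big1 ?addr0 // => m mE.
  by rewrite eq_sym (negPf mE) mulr0 scale0r.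
have -> : p = \sum_(e <- msupp p) p@_e *: ('X_[e] - 'X_[rep (toric_exp e)]).
  under eq_bigr do rewrite scalerBr.
  by rewrite sumrB rep0 subr0 -mpolyE.
apply: in_quad_ideal_sum => e pe; rewrite -mul_mpolyC.
by apply/in_quad_idealM/binom; rewrite repP.
Qed.

(* Factors outside Gamma are silently ignored. *)
Definition factor_exp (s : seq 'X_{1..n}) : 'X_{1..N} :=
  (\sum_(u <- s) [multinom (gam i == u : nat) | i < N])%MM.

Lemma factor_exp_cons u s :
  factor_exp (u :: s) = (factor_exp [:: u] + factor_exp s)%MM.
Proof. by rewrite /factor_exp big_cons big_seq1. Qed.

Lemma gam_inj : injective (@gam n d).
Proof. by move=> i j /val_inj /enum_val_inj. Qed.

Lemma factor_exp_gam i : factor_exp [:: gam i] = U_(i)%MM.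
Proof.
by apply/mnmP => j; rewrite /factor_exp big_seq1 mnmE mnm1E (inj_eq gam_inj) eq_sym.
Qed.

Lemma gamP u :
  reflect (exists i : 'I_N, gam i = u) ((mdeg u == d) && (u != aVec n d)).
Proof.
apply: (iffP idP) => [Gu | [i <-]]; last first.
  by have := enum_valP i; rewrite inE.
have deg_u : (mdeg u < d.+1)%N by case/andP: Gu => /eqP ->.
have GB : BMultinom deg_u \in Gamma n d by rewrite inE.
by exists (enum_rank_in GB (BMultinom deg_u)); rewrite /gam enum_rankK_in.
Qed.

Lemma factor_exp_surj e : exists s : seq 'X_{1..n},
  [/\ all (fun u => (mdeg u == d) && (u != aVec n d)) s,
      e = factor_exp s & (\sum_(u <- s) u)%MM = toric_exp e].
Proof.
have [k] := ubnP (mdeg e); elim: k e => // k IHk e lt_k.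
have [/eqP|e_gt0] := posnP (mdeg e).
  rewrite mdeg_eq0 => /eqP ->; exists [::]; rewrite /factor_exp !big_nil.
  split=> //; apply/mnmP => j; rewrite mnm0E mnm_sumE big1 // => i _.
  by rewrite mulmnE mnm0E muln0.
have [|i e_i] := @mdeg_lt_exists _ 0%MM e; first by rewrite mdeg0.
have le_e : (U_(i) <= e)%MM.
  by apply/mnm_lepP => j; rewrite mnm1E; case: eqP => [<-|//]; apply: leq_ltn_trans e_i.
have [|s [Gs es sum_s]] := IHk (e - U_(i))%MM.
  by move: lt_k; rewrite -{1}(submK le_e) mdegD mdeg1; lia.
exists (gam i :: s); split.
- by rewrite /= Gs andbT; apply/gamP; exists i.
- by rewrite factor_exp_cons factor_exp_gam -es addmC submK.
- by rewrite big_cons sum_s -toric_exp1 -toric_expD addmC submK.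
Qed.

(** A permutation contributes 0, a pair move a monomial times a quadratic binomial of the kernel,
    and transitivity a telescoping sum. *)
Lemma conn_in_quad_ideal (x y : 'I_n) s t :
    aVec n d = omitted d x y -> conn d x y s t ->
  in_quad_ideal ('X_[factor_exp s] - 'X_[factor_exp t]).
Proof.
move=> aE; elim=> {s t} [s t st | u v u' v' s Gu Gv Gu' Gv' eq_uv | s2 s1 s3 _ s12 _ s23].
- by rewrite /factor_exp (perm_big _ st) subrr; apply: in_quad_ideal0.
- have consE u1 u2 : 'X_[K, factor_exp [:: u1, u2 & s]] =
      'X_[factor_exp s] * 'X_[factor_exp [:: u1] + factor_exp [:: u2]].
    by rewrite factor_exp_cons (factor_exp_cons u2) -mpolyXD addmA addmC.
  rewrite !consE -mulrBr.
  move: Gu Gv Gu' Gv' eq_uv; rewrite /inG -aE.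
  move=> /gamP [i <-] /gamP [j <-] /gamP [i' <-] /gamP [j' <-] eq_g.
  rewrite !factor_exp_gam; apply/in_quad_idealM/in_quad_ideal_gen.
    by apply: rpredB; rewrite dhomogX /= mdegD !mdeg1.
  by rewrite toricMapB !toricMapX !toric_expD !toric_exp1 eq_g subrr.
- rewrite -[X in in_quad_ideal (X - _)](subrK 'X_[factor_exp s2]) -addrA.
  exact: in_quad_idealD.
Qed.

End QuadraticIdeal.

Theorem theorem2p3 (K : fieldType) (n d : nat) :
  (2 <= n)%N -> (2 <= d)%N -> d != 3%N -> quadratic_kernel K n d.
Proof.
case: n => [|[|n]] // _ d_ge2 /eqP d_neq3.
(* After the case split [n] is two less than the number of variables, so the last two indices are
   [n] and [n + 1]. *)
pose x : 'I_n.+2 := ord_max; pose y : 'I_n.+2 := inord n.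
have yE : val y = n by rewrite /= inordK.
have neq_xy : x != y by rewrite -val_eqE yE /=; lia.
have aE : aVec n.+2 d = omitted d x y.
  apply/mnmP => i; rewrite mnmE mnmDE mulmnE !mnm1E /= -!val_eqE yE /=.
  by rewrite ![_ == val i]eq_sym /=; do 2 case: eqP => /=; lia.
apply: quadratic_kernel_of_binomials => e f eq_ef.
have [s [Gs es sum_s]] := factor_exp_surj e.
have [t [Gt ft sum_t]] := factor_exp_surj f.
rewrite aE in Gs Gt; rewrite es ft; apply: (conn_in_quad_ideal _ aE).
apply: (fib_conn neq_xy d_ge2 d_neq3 (m := toric_exp e)); split=> //.
by rewrite eq_ef.
Qed.
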